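(* For every $n,r,\ell\in\mathbb{N}$ there exists $R\in\mathbb{N}$ such that the following holds. For any function $F:[R]^r\times[R]^r\to[\ell]$ there exist $n$-element sets $J_1,\ldots,J_r\subseteq[R]$ and a function $C:\{-1,0,1\}^r\to[\ell]$ such that \[F(x,y)=C\bigl(\mathrm{sgn}(y_1-x_1),\ldots,\mathrm{sgn}(y_r-x_r)\bigr)\] for any two $r$-tuples $x=(x_1,\ldots,x_r)$ and $y=(y_1,\ldots,y_r)$ in $J_1\times\cdots\times J_r$.
   Context: $[m]=\{1,\ldots,m\}$. $\mathrm{sgn}(t)=1$ if $t>0$, $0$ if $t=0$, and $-1$ if $t<0$. *)

(* Defs.v *)
From mathcomp Require Import all_boot all_order all_algebra.

Set Implicit Arguments.
Unset Strict Implicit.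
Unset Printing Implicit Defensive.

Import Order.TTheory GRing.Theory Num.Theory.
Local Open Scope ring_scope.

Definition sign3 : Type := {z : int | z \in [:: -1; 0; 1]}.

Lemma sgz_sign3 (t : int) : sgz t \in [:: -1; 0; 1].
Proof. by rewrite !inE; case: sgzP. Qed.

Definition sgn (t : int) : sign3 := exist _ (sgz t) (sgz_sign3 t).

(* [m] = {1, ..., m} is rendered by 'I_m = {0, ..., m-1}; the shift by one
   does not affect the differences y_i - x_i, which are taken in int. *)
Definition sgn_vec (r R : nat) (x y : {ffun 'I_r -> 'I_R}) :
    {ffun 'I_r -> sign3} :=
  [ffun i => sgn ((y i : nat)%:Z - (x i : nat)%:Z)].

(* Main.v *)
Require Import Defs.
From mathcomp Require Import all_boot all_order all_algebra.

Set Implicit Arguments.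
Unset Strict Implicit.
Unset Printing Implicit Defensive.

Import GRing.Theory Num.Theory.

(** Induction on the number of coordinates, over all finite sets of colours.
    Colour a pair (a, b) of values of the new coordinate by the whole function
    (x, y) |-> F (a :: x) (b :: y), with x and y restricted to the finite box
    supplied by the induction hypothesis.  The one-dimensional case (Ramsey's
    theorem for pairs, applied to (f a b, f b a), together with the pigeonhole
    principle on the diagonal) yields a set on which this function only depends
    on sgn (b - a).  The three remaining functions of (x, y) form a single
    colouring with values in K * K * K, to which the induction hypothesis
    applies.  Points are represented by sequences of natural numbers, on which
    colourings are total functions. *)

Lemma pigeonhole_count (T : Type) (K : finType) (h : T -> K) (s : seq T) M :
  #|K| * M < size s -> exists k, M < count (fun x => h x == k) s.
Proof.
move=> lt_s; apply/existsP; rewrite -[X in is_true X]negbK negb_exists.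
apply/negP => /forallP small; move: lt_s; rewrite ltnNge => /negP; apply.
have -> : size s = \sum_(k : K) count (fun x => h x == k) s.
  elim: s {small} => [|x s IHs] /=; first by rewrite big1.
  rewrite big_split /= -IHs (bigD1 (h x)) //= eqxx big1 ?addn0 ?add1n //.
  by move=> k; rewrite eq_sym => /negbTE->.
rewrite -sum_nat_const; apply: leq_sum => k _.
by rewrite leqNgt; apply: small.
Qed.

(** First half of the Erdős-Rado argument for Ramsey's theorem: keep the least element [a], restrict
    to later elements joined to [a] by one popular colour, and recurse inside them. *)
Lemma end_homogeneous_pairs (K : finType) (m : nat) :
  exists M, forall (g : nat -> nat -> K) (s : seq nat),
    sorted ltn s -> M <= size s ->
    exists t (c : nat -> K), [/\ subseq t s, size t = m &
      {in t &, forall a b, a < b -> g a b = c a}].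
Proof.
elim: m => [|m [M IHm]].
  exists 0 => g s _ _; exists [::], (g 0); split=> //.
  exact: sub0seq.
(* Once the head [a] is removed, more than [#|K| * M] elements remain, so some colour class has at
   least [M] of them. *)
exists (#|K| * M).+2 => g [//|a s] /= path_s; rewrite ltnS => lt_s.
have [k lt_k] := pigeonhole_count (g a) lt_s.
have sorted_s := path_sorted path_s.
set s' := [seq x <- s | g a x == k].
have sorted_s' : sorted ltn s' by apply: sorted_filter => //; exact: ltn_trans.
have [|t [c [sub_t size_t ct]]] := IHm g s' sorted_s'.
  by rewrite size_filter ltnW.
have t_gt b : b \in t -> a < b /\ g a b = k.
  move/(mem_subseq sub_t); rewrite mem_filter => /andP[/eqP gab b_s].
  by split=> //; move/(order_path_min ltn_trans)/allP: path_s; apply.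
exists (a :: t), (fun b => if b == a then k else c b); split=> /=.
- by rewrite eqxx (subseq_trans sub_t) ?filter_subseq.
- by rewrite size_t.
move=> x y; rewrite !inE.
case: eqVneq => [-> _|_ /= xt] /orP[/eqP->|yt] lt_xy; first by rewrite ltnn in lt_xy.
- by have [] := t_gt _ yt.
- by have [lt_ax _] := t_gt _ xt; have := ltn_trans lt_xy lt_ax; rewrite ltnn.
exact: ct.
Qed.

Lemma ramsey_sgz (K : finType) (n : nat) :
  exists M, forall f : nat -> nat -> K, exists s (c : int -> K),
    [/\ uniq s, size s = n, all (leq^~ M) s &
        {in s &, forall a b, f a b = c (sgz (b%:Z - a%:Z)%R)}].
Proof.
have [M ramM] := end_homogeneous_pairs (K * K)%type (#|{: K * K * K}| * n).+1.
exists M => f.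
have [|t [c [sub_t size_t ct]]] :=
  ramM (fun a b => (f a b, f b a)) (iota 0 M.+1) (iota_ltn_sorted _ _).
  by rewrite size_iota.
(* Second half of Ramsey: make [c] constant on a subset. Including [f a a] in the pigeonhole settles
   the diagonal as well; [k1], [k2], [k0] are the colours for increasing, decreasing and equal
   pairs. *)
have [|[[k1 k2] k0] lt_k] :=
    @pigeonhole_count _ _ (fun a => (c a, f a a)) t n; first by rewrite size_t.
set s := take n [seq a <- t | (c a, f a a) == (k1, k2, k0)].
have sub_s : subseq s t by rewrite (subseq_trans (take_subseq _ _)) ?filter_subseq.
have sP a : a \in s -> [/\ a \in t, c a = (k1, k2) & f a a = k0].
  by move/mem_take; rewrite mem_filter => /andP[/eqP[-> ->] ->].
exists s, (fun z => if z == 0%R then k0 else if z == 1%R then k1 else k2).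
split.
- exact: subseq_uniq (subseq_trans sub_s sub_t) (iota_uniq _ _).
- by rewrite size_takel // size_filter ltnW.
- apply/allP => a /(mem_subseq sub_s)/(mem_subseq sub_t).
  by rewrite mem_iota add0n ltnS.
move=> a b /sP[at_ ca fa] /sP[bt cb fb].
case: (ltngtP a b) => [lt_ab|lt_ba|<-].
- have := ct _ _ at_ bt lt_ab; rewrite ca => -[-> _].
  by rewrite gtr0_sgz // subr_gt0 ltz_nat.
- have := ct _ _ bt at_ lt_ba; rewrite cb => -[_ ->].
  by rewrite ltr0_sgz // subr_lt0 ltz_nat.
by rewrite subrr sgz0.
Qed.

(** [all2] is false on sequences of different sizes, so membership also fixes the size of [x]. *)
Definition in_box (J : seq (seq nat)) (x : seq nat) :=
  all2 (fun (a : nat) (s : seq nat) => a \in s) x J.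

Definition sgz_seq (x y : seq nat) : seq int :=
  [seq sgz (p.2%:Z - p.1%:Z)%R | p <- zip x y].

(** Sends sequences into a finite type, so that functions on the box can serve as colours. *)
Definition trunc_tuple (r N : nat) (x : seq nat) : r.-tuple 'I_N.+1 :=
  [tuple inord (nth 0 x i) | i < r].

Lemma trunc_tupleK (r N : nat) (x : seq nat) :
  size x = r -> all (leq^~ N) x -> map val (trunc_tuple r N x) = x.
Proof.
move=> size_x /allP le_x; apply: (@eq_from_nth _ 0).
  by rewrite size_map size_tuple.
move=> i; rewrite size_map size_tuple => lt_ir.
rewrite (nth_map ord0) ?size_tuple //.
rewrite -[i]/(nat_of_ord (Ordinal lt_ir)) -tnth_nth tnth_mktuple /= inordK //.
by rewrite ltnS le_x // mem_nth ?size_x.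
Qed.

Lemma in_box_size (J : seq (seq nat)) (x : seq nat) :
  in_box J x -> size x = size J.
Proof. by rewrite /in_box all2E => /andP[/eqP]. Qed.

Lemma in_box_leq (J : seq (seq nat)) (x : seq nat) (N : nat) :
  all (all (leq^~ N)) J -> in_box J x -> all (leq^~ N) x.
Proof.
elim: J x => [|s J IHJ] [|a x] //= /andP[/allP le_s le_J] /andP[/le_s-> xJ].
exact: IHJ.
Qed.

Lemma ramsey_sgz_seq (r n : nat) (K : finType) :
  exists R, forall F : seq nat -> seq nat -> K,
  exists (J : seq (seq nat)) (C : seq int -> K),
    [/\ size J = r,
        all (fun s => uniq s && (size s == n)) J,
        all (all (leq^~ R)) J &
        {in in_box J &, forall x y, F x y = C (sgz_seq x y)}].
Proof.
elim: r K => [|r IHr] K.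
  exists 0 => F; exists [::], (fun=> F [::] [::]); split=> //.
  by move=> [|? ?] [|? ?].
have [N ramN] := IHr (K * K * K)%type.
(* [N] does not depend on [F], so this box gives a finite colour set before [M] is chosen. *)
pose box := (r.-tuple 'I_N.+1 * r.-tuple 'I_N.+1)%type.
have [M ramM] := ramsey_sgz {ffun box -> K} n.
exists (maxn M N) => F.
pose f a b : {ffun box -> K} :=
  [ffun p : box => F (a :: map val p.1) (b :: map val p.2)].
have [s [c [uniq_s size_s le_s cP]]] := ramM f.
pose c' z x y := c z (trunc_tuple r N x, trunc_tuple r N y).
have [J [C [size_J uniq_J le_J CP]]] :=
  ramN (fun x y => (c' 0%R x y, c' 1%R x y, c' (-1)%R x y)).
(* The components of the triple belong to the signs 0, 1 and -1, in this order. *)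
pose pick (z : int) (k : K * K * K) :=
  if z == 0%R then k.1.1 else if z == 1%R then k.1.2 else k.2.
exists (s :: J), (fun z => pick (head 0%R z) (C (behead z))); split=> /=.
- by rewrite size_J.
- by rewrite uniq_s size_s eqxx.
- apply/andP; split.
    by apply: sub_all le_s => a le_a; rewrite leq_max le_a.
  by apply: sub_all le_J => t; apply: sub_all => a le_a; rewrite leq_max le_a orbT.
move=> [|a x] [|b y] // /andP[a_s xJ] /andP[b_s yJ] /=.
rewrite -[[seq _ | _ <- _]]/(sgz_seq x y) -CP //.
have -> : F (a :: x) (b :: y) = c' (sgz (b%:Z - a%:Z)%R) x y.
  (* The entries of [x] and [y] are at most [N], so truncation leaves them unchanged. *)
  rewrite /c' -cP // ffunE !trunc_tupleK ?(in_box_leq le_J) //.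
  - by rewrite (in_box_size yJ).
  - by rewrite (in_box_size xJ).
by rewrite /pick; case: sgzP.
Qed.

Theorem theorem3p3 (n r l : nat) :
  exists R : nat,
    forall F : {ffun 'I_r -> 'I_R} * {ffun 'I_r -> 'I_R} -> 'I_l,
    exists (J : 'I_r -> {set 'I_R}) (C : {ffun 'I_r -> sign3} -> 'I_l),
      (forall i : 'I_r, #|J i| = n) /\
      (forall x y : {ffun 'I_r -> 'I_R},
         (forall i : 'I_r, x i \in J i) ->
         (forall i : 'I_r, y i \in J i) ->
         F (x, y) = C (sgn_vec x y)).
Proof.
have [R ramR] := ramsey_sgz_seq r n 'I_l.
(* Entries are at most [R], so they are the values of ['I_R.+1], on which [inord] is injective. *)
exists R.+1 => F.
pose point (x : seq nat) : {ffun 'I_r -> 'I_R.+1} :=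
  [ffun i : 'I_r => inord (nth 0 x i)].
have [J [C [size_J /allP uniq_J /allP le_J CP]]] :=
  ramR (fun x y => F (point x, point y)).
pose coords (x : {ffun 'I_r -> 'I_R.+1}) : seq nat :=
  [seq val (x i) | i <- enum 'I_r].
have coordsK x : point (coords x) = x.
  apply/ffunP => i; rewrite ffunE (nth_map i) ?size_enum_ord //.
  by rewrite nth_ord_enum inord_val.
have nthJ (i : 'I_r) : nth [::] J i \in J by rewrite mem_nth ?size_J.
exists (fun i => [set j : 'I_R.+1 | val j \in nth [::] J i]).
exists (fun z => C [seq val (z i) | i <- enum 'I_r]); split=> [i|x y xJ yJ].
  have /andP[uniq_Ji /eqP <-] := uniq_J _ (nthJ i).
  have /allP le_Ji := le_J _ (nthJ i).
  (* The cardinality is the size of the duplicate-free image of the sequence under [inord]. *)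
  rewrite -(size_map (@inord R)) -(card_uniqP _); last first.
    rewrite map_inj_in_uniq // => a b /le_Ji le_a /le_Ji le_b /(congr1 val) /=.
    by rewrite !inordK.
  apply: eq_card => j; rewrite inE; apply/idP/mapP => [jJ|[a aJ ->]].
    by exists (val j) => //; rewrite inord_val.
  by rewrite /= inordK // ltnS le_Ji.
have in_boxP (z : {ffun 'I_r -> 'I_R.+1}) :
    (forall i : 'I_r, z i \in [set j : 'I_R.+1 | val j \in nth [::] J i]) ->
    in_box J (coords z).
  have size_z : size (coords z) = r by rewrite size_map size_enum_ord.
  move=> zJ; rewrite /in_box all2E size_z size_J eqxx /=.
  apply/(all_nthP (0, [::])) => i.
  rewrite size_zip size_z size_J minnn => lt_ir.
  rewrite nth_zip ?size_z ?size_J //=.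
  rewrite (nth_map (Ordinal lt_ir)) ?size_enum_ord //.
  rewrite -[i]/(nat_of_ord (Ordinal lt_ir)) nth_ord_enum.
  by have := zJ (Ordinal lt_ir); rewrite inE.
have := CP _ _ (in_boxP _ xJ) (in_boxP _ yJ); rewrite !coordsK => ->.
congr C; rewrite /sgz_seq /coords zip_map -map_comp.
by apply: eq_map => i; rewrite /= ffunE.
Qed.
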